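(* Let $\omega(x,y,z) = xyz - xzy - yxz$ (fourth family, $q=\infty$) and $\omega'(x,y,z) = xyz+zyx$ (Jordan family, $q=\infty$). Then $U(A^{\omega})\cong U(A^{\omega'})$ as unital associative algebras.
   Context: $\mathbb{F}$ is a field of characteristic $0$. $A$ is the 2-dimensional space of $2\times 2$ matrices over $\mathbb{F}$ with zero diagonal, with basis $e_1 = \begin{bmatrix} 0&1\\0&0\end{bmatrix}$, $e_2 = \begin{bmatrix} 0&0\\1&0\end{bmatrix}$; it is closed under triple products $xyz$ of matrices. For a trilinear operation $\omega(x,y,z)$ (a fixed rational linear combination of the six products of $x,y,z$ in all orders), $A^\omega$ denotes the space $A$ with the trilinear operation $\omega$ computed using matrix multiplication. Let $\mathbb{F}\langle a,b\rangle$ be the free unital associative algebra and $\phi\colon A \to \mathbb{F}\langle a,b\rangle$ the linear map with $\phi(e_1)=a$, $\phi(e_2)=b$. The universal associative envelope is $U(A^\omega) = \mathbb{F}\langle a,b\rangle / I$, where $I$ is the two-sided ideal generated by the elements $\omega(\phi(x),\phi(y),\phi(z)) - \phi(\omega(x,y,z))$ for $x,y,z\in\{e_1,e_2\}$. *)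

(* Defs.v *)
From HB Require Import structures.
From mathcomp Require Import all_boot all_order all_algebra.
From mathcomp Require Import boolp.
From mathcomp Require Import monalg.

Set Implicit Arguments.
Unset Strict Implicit.
Unset Printing Implicit Defensive.

Import GRing.Theory.

Local Open Scope ring_scope.
Local Open Scope quotient_scope.

Definition two_sided_ideal (R : nzRingType) (J : R -> Prop) : Prop :=
  [/\ J 0,
      (forall x y, J x -> J y -> J (x - y)),
      (forall a x, J x -> J (a * x)) &
      (forall a x, J x -> J (x * a))].

Definition ideal_gen (R : nzRingType) (G : R -> Prop) (x : R) : Prop :=
  forall J : R -> Prop, two_sided_ideal J -> (forall g, G g -> J g) -> J x.

Lemma ideal_gen_ideal (R : nzRingType) (G : R -> Prop) :
  two_sided_ideal (ideal_gen G).
Proof.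
split.
- by move=> J [].
- by move=> x y Gx Gy J idJ GJ; case: (idJ) => _ JB _ _; apply: JB;
    [apply: Gx|apply: Gy].
- by move=> a x Gx J idJ GJ; case: (idJ) => _ _ JM _; apply: JM; apply: Gx.
- by move=> a x Gx J idJ GJ; case: (idJ) => _ _ _ JM; apply: JM; apply: Gx.
Qed.

Lemma ker_two_sided_ideal (R S : nzRingType) (f : {rmorphism R -> S}) :
  two_sided_ideal (fun x => f x = 0).
Proof.
split; first exact: rmorph0.
- by move=> x y fx fy; rewrite rmorphB fx fy subr0.
- by move=> a x fx; rewrite rmorphM fx mulr0.
- by move=> a x fx; rewrite rmorphM fx mul0r.
Qed.

Definition ideal_pred (R : nzRingType) (G : R -> Prop) : {pred R} :=
  fun x => `[< ideal_gen G x >].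

Lemma ideal_predP (R : nzRingType) (G : R -> Prop) (x : R) :
  reflect (ideal_gen G x) (x \in ideal_pred G).
Proof. exact: asboolP. Qed.

Lemma ideal_pred_zmod_closed (R : nzRingType) (G : R -> Prop) :
  zmod_closed (ideal_pred G).
Proof.
have [G0 GB _ _] := ideal_gen_ideal G.
split; first by apply/ideal_predP.
move=> x y /ideal_predP Gx /ideal_predP Gy.
by apply/ideal_predP; apply: GB.
Qed.

HB.instance Definition _ (R : nzRingType) (G : R -> Prop) :=
  GRing.isZmodClosed.Build R (ideal_pred G) (ideal_pred_zmod_closed G).

Section QuotientAlgebra.
Variables (F : fieldType) (R : algType F) (G : R -> Prop).

(* An algType is nontrivial, whence the argument G1. *)
Definition quot_alg (G1 : ~ ideal_gen G 1) : Type :=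
  Quotient.quot (ideal_pred G).

Variable G1 : ~ ideal_gen G 1.
Local Notation Q := (quot_alg G1).

HB.instance Definition _ := GRing.Zmodule.on Q.
HB.instance Definition _ :=
  ZmodQuotient.copy Q (Quotient.quot (ideal_pred G)).

Let one : Q := \pi_Q 1.
Let mul (x y : Q) : Q := \pi_Q (repr x * repr y).
Let scale (c : F) (x : Q) : Q := \pi_Q (c *: repr x).

Lemma quot_alg_eqP (x y : R) :
  reflect (ideal_gen G (x - y)) (\pi_Q x == \pi_Q y).
Proof. by rewrite -Quotient.idealrBE; apply: ideal_predP. Qed.

Lemma ideal_gen_reprB (x : R) : ideal_gen G (repr (\pi_Q x) - x).
Proof. by apply/quot_alg_eqP; rewrite reprK. Qed.

Fact quot_alg_pi_mul (x y : R) : \pi_Q (x * y) = mul (\pi_Q x) (\pi_Q y).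
Proof.
apply/esym/eqP/quot_alg_eqP.
have [_ GB GMl GMr] := ideal_gen_ideal G.
have -> : repr (\pi_Q x) * repr (\pi_Q y) - x * y =
    (repr (\pi_Q x) - x) * repr (\pi_Q y) - x * - (repr (\pi_Q y) - y).
  by rewrite mulrN opprK mulrBl mulrBr addrA subrK.
apply: GB; first by apply: GMr; apply: ideal_gen_reprB.
rewrite mulrN -mulNr; apply: GMl; exact: ideal_gen_reprB.
Qed.

Fact quot_alg_pi_scale (c : F) (x : R) : \pi_Q (c *: x) = scale c (\pi_Q x).
Proof.
apply/esym/eqP/quot_alg_eqP.
have [_ _ GMl _] := ideal_gen_ideal G.
rewrite -scalerBr -[_ - x]mul1r scalerAl; apply: GMl.
exact: ideal_gen_reprB.
Qed.

Fact quot_alg_pi_add (x y : R) : \pi_Q (x + y) = \pi_Q x + \pi_Q y.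
Proof. exact: Quotient.pi_add. Qed.

Let piP (x : Q) : x = \pi_Q (repr x). Proof. by rewrite reprK. Qed.

Fact quot_alg_mulA : associative mul.
Proof.
move=> x y z; rewrite (piP x) (piP y) (piP z).
by rewrite -!quot_alg_pi_mul mulrA.
Qed.

Fact quot_alg_mul1 : left_id one mul.
Proof. by move=> x; rewrite (piP x) -quot_alg_pi_mul mul1r. Qed.

Fact quot_alg_mulr1 : right_id one mul.
Proof. by move=> x; rewrite (piP x) -quot_alg_pi_mul mulr1. Qed.

Fact quot_alg_mulDl : left_distributive mul +%R.
Proof.
move=> x y z; rewrite (piP x) (piP y) (piP z).
by rewrite -quot_alg_pi_add -!quot_alg_pi_mul -quot_alg_pi_add mulrDl.
Qed.

Fact quot_alg_mulDr : right_distributive mul +%R.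
Proof.
move=> x y z; rewrite (piP x) (piP y) (piP z).
by rewrite -quot_alg_pi_add -!quot_alg_pi_mul -quot_alg_pi_add mulrDr.
Qed.

Fact quot_alg_one_neq0 : one != 0.
Proof.
have -> : (0 : Q) = \pi_Q 0 by rewrite !piE.
by apply/negP => /quot_alg_eqP; rewrite subr0.
Qed.

HB.instance Definition _ := GRing.Zmodule_isNzRing.Build Q
  quot_alg_mulA quot_alg_mul1 quot_alg_mulr1 quot_alg_mulDl quot_alg_mulDr
  quot_alg_one_neq0.

Fact quot_alg_scaleA (c d : F) (x : Q) : scale c (scale d x) = scale (c * d) x.
Proof. by rewrite (piP x) -!quot_alg_pi_scale scalerA. Qed.

Fact quot_alg_scale1 : left_id 1 scale.
Proof. by move=> x; rewrite (piP x) -quot_alg_pi_scale scale1r. Qed.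

Fact quot_alg_scaleDr : right_distributive scale +%R.
Proof.
move=> c x y; rewrite (piP x) (piP y) -quot_alg_pi_add -!quot_alg_pi_scale.
by rewrite -quot_alg_pi_add scalerDr.
Qed.

Fact quot_alg_scaleDl (x : Q) :
  {morph (fun c => scale c x) : c d / c + d >-> c + d}.
Proof.
move=> c d; rewrite (piP x) -!quot_alg_pi_scale.
by rewrite -quot_alg_pi_add scalerDl.
Qed.

HB.instance Definition _ := GRing.Zmodule_isLmodule.Build F Q
  quot_alg_scaleA quot_alg_scale1 quot_alg_scaleDr quot_alg_scaleDl.

Fact quot_alg_scaleAl (c : F) (x y : Q) : c *: (x * y) = (c *: x) * y.
Proof.
rewrite (piP x) (piP y); change (scale c (mul (\pi_Q (repr x)) (\pi_Q (repr y)))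
  = mul (scale c (\pi_Q (repr x))) (\pi_Q (repr y))).
by rewrite -quot_alg_pi_mul -!quot_alg_pi_scale -quot_alg_pi_mul scalerAl.
Qed.

HB.instance Definition _ :=
  GRing.Lmodule_isLalgebra.Build F Q quot_alg_scaleAl.

Fact quot_alg_scaleAr (c : F) (x y : Q) : c *: (x * y) = x * (c *: y).
Proof.
rewrite (piP x) (piP y); change (scale c (mul (\pi_Q (repr x)) (\pi_Q (repr y)))
  = mul (\pi_Q (repr x)) (scale c (\pi_Q (repr y)))).
by rewrite -quot_alg_pi_mul -!quot_alg_pi_scale -quot_alg_pi_mul scalerAr.
Qed.

HB.instance Definition _ :=
  GRing.Lalgebra_isAlgebra.Build F Q quot_alg_scaleAr.

HB.instance Definition _ := isNzRingQuotient.Build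
  R (Quotient.equiv (ideal_pred G)) 0 -%R +%R 1 *%R Q
  (erefl _) quot_alg_pi_mul.

End QuotientAlgebra.

(* F<a,b>, as the monoid algebra over F of the free monoid on 'I_2. *)

Definition free2 (F : fieldType) : Type := {malg F[{fmonom 'I_2}]}.

Section Free2.
Variable F : fieldType.

HB.instance Definition _ := GRing.Lalgebra.on (free2 F).

Let malg_scaleAr (K : monomType) (c : F) (x y : {malg F[K]}) :
  c *: (x * y) = x * (c *: y).
Proof.
apply/malgP => k; rewrite mcoeffZ mcoeffMl [RHS]mcoeffMl mulr_sumr.
under [RHS]eq_bigr => k1 _.
  rewrite (finmap.big_fset_incl _ (msuppZ_le c y)) /=; last first.
    by move=> k2 _ /mcoeff_outdom ->; rewrite mulr0 mul0rn.
  over.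
apply: eq_bigr => k1 _; rewrite mulr_sumr; apply: eq_bigr => k2 _.
by rewrite mcoeffZ mulrnAr mulrCA.
Qed.

Fact free2_scaleAr (c : F) (x y : free2 F) : c *: (x * y) = x * (c *: y).
Proof. exact: malg_scaleAr. Qed.

HB.instance Definition _ :=
  GRing.Lalgebra_isAlgebra.Build F (free2 F) free2_scaleAr.

Definition gen_a : free2 F := << fmu (0 : 'I_2) >>.
Definition gen_b : free2 F := << fmu (1 : 'I_2) >>.

End Free2.

(* A trilinear operation is given by the rational coefficients of the six     *)
(* products of its arguments.                                                 *)

Record triop : Type := TriOp {
  c_xyz : rat; c_xzy : rat; c_yxz : rat;
  c_yzx : rat; c_zxy : rat; c_zyx : rat }.

Definition trieval (F : fieldType) (B : algType F) (w : triop)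
    (x y z : B) : B :=
  ratr (c_xyz w) *: (x * y * z) + ratr (c_xzy w) *: (x * z * y)
  + ratr (c_yxz w) *: (y * x * z) + ratr (c_yzx w) *: (y * z * x)
  + ratr (c_zxy w) *: (z * x * y) + ratr (c_zyx w) *: (z * y * x).

(* The members q = infinity of the fourth and of the Jordan family. *)
Definition omega_fourth_inf : triop :=
  {| c_xyz := 1; c_xzy := -1; c_yxz := -1;
     c_yzx := 0; c_zxy := 0; c_zyx := 0 |}.

Definition omega_jordan_inf : triop :=
  {| c_xyz := 1; c_xzy := 0; c_yxz := 0;
     c_yzx := 0; c_zxy := 0; c_zyx := 1 |}.

Lemma omega_fourth_infE (F : fieldType) (B : algType F) (x y z : B) :
  trieval omega_fourth_inf x y z = x * y * z - x * z * y - y * x * z.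
Proof.
rewrite /trieval /= (ratr_int F (-1)) (ratr_int F 0) (ratr_int F 1).
by rewrite mulrN1z mulr0z mulr1z !scaleN1r !scale0r scale1r !addr0.
Qed.

Lemma omega_jordan_infE (F : fieldType) (B : algType F) (x y z : B) :
  trieval omega_jordan_inf x y z = x * y * z + z * y * x.
Proof.
rewrite /trieval /= (ratr_int F 0) (ratr_int F 1).
by rewrite mulr0z mulr1z !scale0r !scale1r !addr0.
Qed.

Definition zero_diag (F : fieldType) : {pred 'M[F]_2} :=
  fun M => [forall i, M i i == 0].

Lemma zero_diagP (F : fieldType) (M : 'M[F]_2) :
  reflect (forall i, M i i = 0) (M \in @zero_diag F).
Proof. exact: 'forall_eqP. Qed.

Fact zero_diag_submod_closed (F : fieldType) : submod_closed (@zero_diag F).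
Proof.
split; first by apply/zero_diagP => i; rewrite mxE.
move=> c M N /zero_diagP M0 /zero_diagP N0; apply/zero_diagP => i.
by rewrite !mxE M0 N0 mulr0 addr0.
Qed.

HB.instance Definition _ (F : fieldType) :=
  GRing.isSubmodClosed.Build F 'M[F]_2 (@zero_diag F)
    (@zero_diag_submod_closed F).

Record triA (F : fieldType) : predArgType :=
  TriA { mx_of_triA : 'M[F]_2; _ : mx_of_triA \in @zero_diag F }.

HB.instance Definition _ (F : fieldType) := [isSub for @mx_of_triA F].
HB.instance Definition _ (F : fieldType) := [Choice of triA F by <:].
HB.instance Definition _ (F : fieldType) :=
  [SubChoice_isSubLmodule of triA F by <:].

Section TripleSystem.
Variable F : fieldType.

Fact zero_diag_delta (i j : 'I_2) :
  i != j -> delta_mx i j \in @zero_diag F.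
Proof.
move=> /negP nij; apply/zero_diagP => k; rewrite mxE.
by case: andP => // -[/eqP ki /eqP kj]; case: nij; rewrite -ki -kj.
Qed.

Definition e1 : triA F := TriA (@zero_diag_delta 0 1 isT).
Definition e2 : triA F := TriA (@zero_diag_delta 1 0 isT).

Fact zero_diag_mul3 (M N P : 'M[F]_2) :
    M \in @zero_diag F -> N \in @zero_diag F -> P \in @zero_diag F ->
  M * N * P \in @zero_diag F.
Proof.
move=> /zero_diagP M0 /zero_diagP N0 /zero_diagP P0; apply/zero_diagP => i.
rewrite -mulrA mxE big1 // => j _.
have [<-|nij] := eqVneq i j; first by rewrite M0 mul0r.
rewrite mxE big1 ?mulr0 // => k _.
have [<-|nik] := eqVneq i k; first by rewrite P0 mulr0.
suff -> : k = j by rewrite N0 mul0r.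
move: nij nik; case: i => [[|[|//]] ?]; case: j => [[|[|//]] ?];
  by case: k => [[|[|//]] ?] //= _ _; apply: val_inj.
Qed.

Fact zero_diag_trieval (w : triop) (x y z : triA F) :
  trieval w (val x) (val y) (val z) \in @zero_diag F.
Proof.
have V u : val u \in @zero_diag F := valP u.
by rewrite /trieval !rpredD // rpredZ // zero_diag_mul3.
Qed.

(* The operation of A^omega. *)
Definition triA_op (w : triop) (x y z : triA F) : triA F :=
  TriA (zero_diag_trieval w x y z).

Definition phi (x : triA F) : free2 F :=
  val x 0 1 *: gen_a F + val x 1 0 *: gen_b F.

Let comb_linear (V : lmodType F) (c s t s' t' : F) (a b : V) :
  (c * s + s') *: a + (c * t + t') *: b
  = c *: (s *: a + t *: b) + (s' *: a + t' *: b).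
Proof. by rewrite !scalerDl scalerDr !scalerA addrACA. Qed.

Fact phi_is_linear : linear phi.
Proof.
have valE c (x y : triA F) i j :
    val (c *: x + y) i j = c * val x i j + val y i j.
  by rewrite (linearP (val : {linear triA F -> 'M[F]_2})) !mxE.
move=> c x y; rewrite /phi !valE; exact: comb_linear.
Qed.

HB.instance Definition _ :=
  GRing.isLinear.Build F (triA F) (free2 F) *:%R phi phi_is_linear.

Lemma phi_e1 : phi e1 = gen_a F.
Proof. by rewrite /phi !mxE /= scale1r scale0r addr0. Qed.

Lemma phi_e2 : phi e2 = gen_b F.
Proof. by rewrite /phi !mxE /= scale1r scale0r add0r. Qed.

Definition env_rel (w : triop) (g : free2 F) : Prop :=
  exists x y z : triA F,
    [/\ x \in [:: e1; e2], y \in [:: e1; e2], z \in [:: e1; e2] &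
        g = trieval w (phi x) (phi y) (phi z) - phi (triA_op w x y z)].

Let trieval_ker (B : algType F) (eps : {rmorphism B -> F}) (w : triop)
    (x y z v : B) :
    (forall c p, eps (c *: p) = c * eps p) ->
  eps x = 0 -> eps y = 0 -> eps z = 0 -> eps v = 0 ->
  eps (trieval w x y z - v) = 0.
Proof.
move=> epsZ x0 y0 z0 v0; rewrite /trieval rmorphB !rmorphD !epsZ !rmorphM /=.
by rewrite x0 y0 z0 v0 !mul0r !mulr0 !addr0 subr0.
Qed.

Let comb_ker (B : algType F) (eps : {rmorphism B -> F}) (a b : B) (s t : F) :
    (forall c p, eps (c *: p) = c * eps p) ->
  eps a = 0 -> eps b = 0 -> eps (s *: a + t *: b) = 0.
Proof. by move=> epsZ a0 b0; rewrite rmorphD !epsZ a0 b0 !mulr0 addr0. Qed.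

(* The defining relations have no constant term. *)
Fact env_rel_proper (w : triop) : ~ ideal_gen (env_rel w) 1.
Proof.
pose eps : {rmorphism free2 F -> F} := @mcoeff {fmonom 'I_2} F mone.
have epsZ c p : eps (c *: p) = c * eps p by exact: mcoeffZ.
have epsU (i : 'I_2) : eps << fmu i >> = 0.
  by rewrite /eps /= mcoeffU -val_eqE /= fmuE fm1.
have eps_phi x : eps (phi x) = 0.
  exact: (comb_ker _ _ epsZ (epsU 0) (epsU 1)).
move=> /(_ _ (ker_two_sided_ideal eps)) I1.
suff /I1/eqP : forall g, env_rel w g -> eps g = 0 by rewrite rmorph1 oner_eq0.
move=> _ [x [y [z [_ _ _ ->]]]].
exact: (trieval_ker _ epsZ (eps_phi x) (eps_phi y) (eps_phi z) (eps_phi _)).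
Qed.

Definition universal_envelope (w : triop) : algType F :=
  quot_alg (@env_rel_proper w).

End TripleSystem.

(* Main.v *)
Require Import Defs.
From HB Require Import structures.
From mathcomp Require Import all_boot all_order all_algebra.

Import GRing.Theory.

Local Open Scope ring_scope.
Local Open Scope quotient_scope.

(** Evaluated on the basis, both operations yield, up to sign, the factor 2 and
    linear combinations, the same relations [a^3 = b^3 = 0], [aba = a],
    [bab = b], [a^2 b + b a^2 = 0] and [b^2 a + a b^2 = 0].  Hence the two
    ideals of the free algebra coincide, and so do the quotients. *)

(** * Quotients of an algebra by two equal ideals *)

Section EqualIdeals.
Variables (F : fieldType) (R : algType F) (G G' : R -> Prop).
Hypotheses (G1 : ~ ideal_gen G 1) (G1' : ~ ideal_gen G' 1).
Hypothesis eqGG' : forall x, ideal_gen G x <-> ideal_gen G' x.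
Local Notation Q := (quot_alg G1).
Local Notation Q' := (quot_alg G1').

Definition quot_change (x : Q) : Q' := \pi_Q' (repr x).

(** Independence of the chosen representative: [repr (\pi_Q x)] and [x] differ by an element of the
    first ideal, hence of the second. *)
Lemma quot_change_pi (x : R) : quot_change (\pi_Q x) = \pi_Q' x.
Proof.
by apply/eqP/(quot_alg_eqP G1')/eqGG'; apply: ideal_gen_reprB.
Qed.

Fact quot_change_is_linear : linear quot_change.
Proof.
move=> c x y; rewrite -[x]reprK -[y]reprK.
(* Stated for any [H], since it serves in the source and again in the target. *)
have pi_lin (H : R -> Prop) (H1 : ~ ideal_gen H 1) (u v : R) :
    c *: (\pi_(quot_alg H1) u) + \pi_(quot_alg H1) v
    = \pi_(quot_alg H1) (c *: u + v).
  by rewrite quot_alg_pi_add quot_alg_pi_scale.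
by rewrite pi_lin !quot_change_pi pi_lin.
Qed.

Fact quot_change_is_monoid_morphism : monoid_morphism quot_change.
Proof.
split; first exact: quot_change_pi.
move=> x y; rewrite -[x]reprK -[y]reprK.
have pi_mul (H : R -> Prop) (H1 : ~ ideal_gen H 1) (u v : R) :
    (\pi_(quot_alg H1) u) * \pi_(quot_alg H1) v
    = \pi_(quot_alg H1) (u * v).
  by rewrite quot_alg_pi_mul.
by rewrite pi_mul !quot_change_pi pi_mul.
Qed.

HB.instance Definition _ :=
  GRing.isLinear.Build F Q Q' *:%R quot_change quot_change_is_linear.
HB.instance Definition _ :=
  GRing.isMonoidMorphism.Build Q Q' quot_change quot_change_is_monoid_morphism.

Definition quot_change_lrmorphism : {lrmorphism Q -> Q'} := quot_change.

End EqualIdeals.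

Arguments quot_change {F R G G' G1 G1'}.
Arguments quot_change_lrmorphism {F R G G' G1 G1'}.

(** The inverse is the same map with the two ideals exchanged. *)
Lemma quot_change_bij (F : fieldType) (R : algType F) (G G' : R -> Prop)
    (G1 : ~ ideal_gen G 1) (G1' : ~ ideal_gen G' 1)
    (eqGG' : forall x, ideal_gen G x <-> ideal_gen G' x) :
  bijective (quot_change : quot_alg G1 -> quot_alg G1').
Proof.
have eqG'G x : ideal_gen G' x <-> ideal_gen G x by split=> /eqGG'.
exists (quot_change : quot_alg G1' -> quot_alg G1) => x;
  by rewrite -[x]reprK !quot_change_pi ?reprK.
Qed.

(** * Closure properties of two-sided ideals *)

Section IdealClosure.
Variables (F : fieldType) (R : algType F) (J : R -> Prop).
Hypothesis idJ : two_sided_ideal J.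

Lemma two_sided_idealN x : J x -> J (- x).
Proof. by case: idJ => J0 JB _ _ Jx; rewrite -sub0r; apply: JB. Qed.

Lemma two_sided_idealD x y : J x -> J y -> J (x + y).
Proof.
case: idJ => _ JB _ _ Jx Jy; rewrite -[y]opprK; apply: JB => //.
exact: two_sided_idealN.
Qed.

(** Scalars act as multiplication by [c%:A], so an ideal absorbs the factor 1/2. *)
Lemma two_sided_ideal_half x : 2%:R != 0 :> F -> J (x + x) -> J x.
Proof.
case: idJ => _ _ JM _ F2 /(JM (2%:R^-1)%:A).
by rewrite -scalerAl mul1r -mulr2n -scaler_nat scalerA mulVf ?scale1r.
Qed.

End IdealClosure.

Definition envelope_relations (R : nzRingType) (a b : R) (J : R -> Prop) :=
  (J (a * a * a) /\ J (b * b * b)) /\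
  (J (a * b * a - a) /\ J (b * a * b - b)) /\
  (J (a * a * b + b * a * a) /\ J (b * b * a + a * b * b)).

Definition on_basis_triples (T : Type) (x y : T) (P : T -> T -> T -> Prop) : Prop :=
  [/\ P x x x, P x x y, P x y x & P x y y] /\
  [/\ P y x x, P y x y, P y y x & P y y y].

(** * The relations on basis triples, computed in coordinates *)

Section Tables.
Variables (F : fieldType) (B : algType F) (a b : B).

(* A pair (s, t) stands for the element s e1 + t e2 of A; the product of three
   such elements has coordinates (s1 t2 s3, t1 s2 t3). *)
Definition comb (p : F * F) : B := p.1 *: a + p.2 *: b.

(** The relator of the fourth family written in coordinates, so that the tables need no matrices. *)
Definition fourth_form (x y z : F * F) : B :=
  comb x * comb y * comb z - comb x * comb z * comb y - comb y * comb x * comb z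
  - comb (x.1 * y.2 * z.1 - x.1 * z.2 * y.1 - y.1 * x.2 * z.1,
          x.2 * y.1 * z.2 - x.2 * z.1 * y.2 - y.2 * x.1 * z.2).

Definition jordan_form (x y z : F * F) : B :=
  comb x * comb y * comb z + comb z * comb y * comb x
  - comb (x.1 * y.2 * z.1 + z.1 * y.2 * x.1, x.2 * y.1 * z.2 + z.2 * y.1 * x.2).

(** Here [*] between equations is the product of types: the table is one tuple, usable as a rewrite
    multirule. *)
Lemma fourth_table :
  (fourth_form (1, 0) (1, 0) (1, 0) = - (a * a * a)) *
  (fourth_form (1, 0) (1, 0) (0, 1) = - (a * b * a - a)) *
  (fourth_form (1, 0) (0, 1) (1, 0) =
     (a * b * a - a) - (a * a * b + b * a * a)) *
  (fourth_form (1, 0) (0, 1) (0, 1) = - (b * a * b - b)) *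
  (fourth_form (0, 1) (1, 0) (1, 0) = - (a * b * a - a)) *
  (fourth_form (0, 1) (1, 0) (0, 1) =
     (b * a * b - b) - (b * b * a + a * b * b)) *
  (fourth_form (0, 1) (0, 1) (1, 0) = - (b * a * b - b)) *
  (fourth_form (0, 1) (0, 1) (0, 1) = - (b * b * b)).
Proof.
rewrite /fourth_form /comb /= !(mul0r, mulr0, mul1r, subr0, sub0r).
rewrite !(scale0r, scale1r, scaleN1r, addr0, add0r, subr0, opprK).
(* [drop] treats the triples [x, x, y], where the outer monomials cancel; [shift] treats [x, y, x],
   where nothing cancels. *)
have drop x y z : x - y - x + z = - (y - z) :> B.
  by rewrite [x - y - x]addrAC subrr sub0r opprB addrC.
have shift x y z t : x - y - z - t = x - t - (y + z) :> B.
  by rewrite opprD addrA [LHS]addrAC [x - y - t]addrAC.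
by do ![split]; rewrite ?subrr ?sub0r ?drop ?shift // opprD opprK.
Qed.

Lemma jordan_table :
  (jordan_form (1, 0) (1, 0) (1, 0) = a * a * a + a * a * a) *
  (jordan_form (1, 0) (1, 0) (0, 1) = a * a * b + b * a * a) *
  (jordan_form (1, 0) (0, 1) (1, 0) = (a * b * a - a) + (a * b * a - a)) *
  (jordan_form (1, 0) (0, 1) (0, 1) = b * b * a + a * b * b) *
  (jordan_form (0, 1) (1, 0) (1, 0) = a * a * b + b * a * a) *
  (jordan_form (0, 1) (1, 0) (0, 1) = (b * a * b - b) + (b * a * b - b)) *
  (jordan_form (0, 1) (0, 1) (1, 0) = b * b * a + a * b * b) *
  (jordan_form (0, 1) (0, 1) (0, 1) = b * b * b + b * b * b).
Proof.
rewrite /jordan_form /comb /= !(mul0r, mulr0, mul1r, addr0, add0r).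
rewrite !(scale0r, scale1r, scalerDl, addr0, add0r, subr0).
have double x y : x + x - (y + y) = x - y + (x - y) :> B.
  by rewrite opprD addrACA.
by do ![split] => //; first [exact: double | exact: addrC].
Qed.

Variable J : B -> Prop.
Hypothesis idJ : two_sided_ideal J.
Let JN := two_sided_idealN F B J idJ.
Let JD := two_sided_idealD F B J idJ.

(** The table is triangular: up to sign, six entries give the cubes, [aba - a] and [bab - b];
    subtracting the latter two from the mixed entries leaves the two sums. *)
Lemma fourth_form_ideal :
  on_basis_triples _ (1, 0) (0, 1) (fun x y z => J (fourth_form x y z)) <->
  envelope_relations _ a b J.
Proof.
have JN' x : J (- x) -> J x by move=> /JN; rewrite opprK.
have JB x y : J x -> J (x - y) -> J y.
  by move=> Jx /JN /(JD _ _ Jx); rewrite opprB addrC subrK.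
rewrite /on_basis_triples !fourth_table; split; last first.
  move=> [[aaa bbb] [[aba bab] [aab bba]]].
  by split; split; try exact: JN; apply: JD => //; apply: JN.
move=> [[/JN' aaa /JN' aba aab /JN' bab] [_ bba _ /JN' bbb]].
by split=> //; split=> //; split; [exact: JB aab | exact: JB bba].
Qed.

(** The palindromic triples give doubled relations, which is where 2 must be invertible. *)
Lemma jordan_form_ideal : 2%:R != 0 :> F ->
  on_basis_triples _ (1, 0) (0, 1) (fun x y z => J (jordan_form x y z)) <->
  envelope_relations _ a b J.
Proof.
move=> F2; have Jhalf x := two_sided_ideal_half F B J idJ x F2.
rewrite /on_basis_triples !jordan_table; split; last first.
  move=> [[aaa bbb] [[aba bab] [aab bba]]].
  by split; split=> //; apply: JD.
by move=> [[/Jhalf aaa aab /Jhalf aba bba] [_ /Jhalf bab _ /Jhalf bbb]].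
Qed.

End Tables.

(** * From the defining relations of the envelopes to the tables *)

Section Relations.
Variable F : fieldType.
Local Notation a := (gen_a F).
Local Notation b := (gen_b F).
Local Notation e1 := (e1 F).
Local Notation e2 := (e2 F).

Definition relator (w : triop) (x y z : triA F) : free2 F :=
  trieval w (phi x) (phi y) (phi z) - phi (triA_op w x y z).

Lemma env_rel_ideal w (J : free2 F -> Prop) :
  (forall g, env_rel w g -> J g) <->
  on_basis_triples _ e1 e2 (fun x y z => J (relator w x y z)).
Proof.
have m1 : e1 \in [:: e1; e2] by apply: mem_head.
have m2 : e2 \in [:: e1; e2] by rewrite in_cons mem_head orbT.
split=> [Jw | [[J1 J2 J3 J4] [J5 J6 J7 J8]] g [x [y [z [+ + + ->]]]]].
  have B x y z : x \in [:: e1; e2] -> y \in [:: e1; e2] -> z \in [:: e1; e2] ->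
      J (relator w x y z) by move=> *; apply: Jw; exists x, y, z.
  by split; split; exact: B.
rewrite !inE => /orP[]/eqP-> /orP[]/eqP-> /orP[]/eqP->;
  [exact: J1|exact: J2|exact: J3|exact: J4|exact: J5|exact: J6|exact: J7|].
exact: J8.
Qed.

(** With this order of the entries, [phi x] is [comb] at [coords x] by conversion. *)
Definition coords (x : triA F) : F * F := (val x 0 1, val x 1 0).

Lemma mulmx2E (M N : 'M[F]_2) i j : (M * N) i j = M i 0 * N 0 j + M i 1 * N 1 j.
Proof.
rewrite mxE !big_ord_recl big_ord0 addr0.
by congr (M i _ * N _ j + M i _ * N _ j); apply: val_inj.
Qed.

(** With zero diagonals, the only index path from 0 to 1 in three steps is 0, 1, 0, 1. *)
Lemma mul3_upper (x y z : triA F) :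
  (val x * val y * val z) 0 1 = (coords x).1 * (coords y).2 * (coords z).1.
Proof.
have [/zero_diagP x0 /zero_diagP z0] := (valP x, valP z).
by rewrite !mulmx2E !x0 !z0 !(mul0r, mulr0, add0r, addr0).
Qed.

Lemma mul3_lower (x y z : triA F) :
  (val x * val y * val z) 1 0 = (coords x).2 * (coords y).1 * (coords z).2.
Proof.
have [/zero_diagP x0 /zero_diagP z0] := (valP x, valP z).
by rewrite !mulmx2E !x0 !z0 !(mul0r, mulr0, add0r, addr0).
Qed.

Lemma coords_e1 : coords e1 = (1, 0).
Proof. by rewrite /coords !mxE. Qed.

Lemma coords_e2 : coords e2 = (0, 1).
Proof. by rewrite /coords !mxE. Qed.

Lemma fourth_relatorE (x y z : triA F) :
  relator omega_fourth_inf x y z =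
  fourth_form F (free2 F) a b (coords x) (coords y) (coords z).
Proof.
have entryBB (M N P : 'M[F]_2) i j :
  (M - N - P) i j = M i j - N i j - P i j by rewrite !mxE.
rewrite /relator omega_fourth_infE [phi (triA_op _ _ _ _)]/phi.
rewrite [val (triA_op _ _ _ _)]/= omega_fourth_infE !entryBB.
by rewrite !mul3_upper !mul3_lower.
Qed.

Lemma jordan_relatorE (x y z : triA F) :
  relator omega_jordan_inf x y z =
  jordan_form F (free2 F) a b (coords x) (coords y) (coords z).
Proof.
have entryD (M N : 'M[F]_2) i j : (M + N) i j = M i j + N i j by rewrite mxE.
rewrite /relator omega_jordan_infE [phi (triA_op _ _ _ _)]/phi.
rewrite [val (triA_op _ _ _ _)]/= omega_jordan_infE !entryD.
by rewrite !mul3_upper !mul3_lower.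
Qed.

Lemma fourth_ideal (J : free2 F -> Prop) :
  two_sided_ideal J ->
  (forall g, env_rel omega_fourth_inf g -> J g) <->
  envelope_relations _ a b J.
Proof.
move=> idJ; rewrite env_rel_ideal /on_basis_triples !fourth_relatorE.
rewrite !coords_e1 !coords_e2; exact: fourth_form_ideal.
Qed.

Lemma jordan_ideal (J : free2 F -> Prop) :
  two_sided_ideal J -> 2%:R != 0 :> F ->
  (forall g, env_rel omega_jordan_inf g -> J g) <->
  envelope_relations _ a b J.
Proof.
move=> idJ F2; rewrite env_rel_ideal /on_basis_triples !jordan_relatorE.
rewrite !coords_e1 !coords_e2; exact: jordan_form_ideal.
Qed.

End Relations.

Theorem proposition5p7 (F : fieldType) (charF0 : [pchar F] =i pred0) :
  exists f : {lrmorphism universal_envelope F omega_fourth_inf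
                         -> universal_envelope F omega_jordan_inf},
    bijective f.
Proof.
have F2 : 2%:R != 0 :> F.
  by apply/negP => F2; have := charF0 2; rewrite inE /= F2.
have eqI (x : free2 F) : ideal_gen (env_rel omega_fourth_inf) x <->
                           ideal_gen (env_rel omega_jordan_inf) x.
  (* A generated ideal is the intersection of the ideals containing the generators. Both generating
     sets lie in the same ideals [J], namely those satisfying [envelope_relations]. *)
  split=> Ix J idJ HJ; apply: (Ix J idJ).
    exact: iffRL (fourth_ideal F J idJ) (iffLR (jordan_ideal F J idJ F2) HJ).
  exact: iffRL (jordan_ideal F J idJ F2) (iffLR (fourth_ideal F J idJ) HJ).
exists (quot_change_lrmorphism eqI); exact: quot_change_bij.
Qed.
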